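(* For all integers $r \ge 2$ and $n \ge 1$, $$\left|\mathrm{Cyc}_r(n)\right| \le \left|\mathrm{Reg}_r(n)\right|,$$ where equality holds only when $r=2$ and $n$ is even.
   Context: Permutations of $[n]=\{1,\dots,n\}$ are viewed through their disjoint cycle decompositions, fixed points counting as cycles of length $1$. $\mathrm{Reg}_r(n)$ is the set of permutations of $[n]$ none of whose cycle lengths is divisible by $r$. $\mathrm{Cyc}_r(n)$ is the set of permutations of $[n]$ all of whose cycle lengths are divisible by $r$. *)

(* Defs.v *)
From mathcomp Require Import all_boot all_fingroup.

Set Implicit Arguments.
Unset Strict Implicit.
Unset Printing Implicit Defensive.

(* Permutations of [n] are elements of 'S_n, acting on 'I_n = {0, .., n-1}.
   [porbits s] is the set of supports of the disjoint cycles of s, with each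
   fixed point contributing a singleton; the length of the cycle with support
   c is #|c|. *)

Definition Reg (r n : nat) : {set 'S_n} :=
  [set s : 'S_n | [forall c in porbits s, ~~ (r %| #|c|)]].

Definition Cyc (r n : nat) : {set 'S_n} :=
  [set s : 'S_n | [forall c in porbits s, r %| #|c|]].

(* Main.v *)
Require Import Defs.
From mathcomp Require Import all_boot all_fingroup.

(* Splitting off the cycle through a chosen element shows that the number f(n) of
   permutations of [n] with all cycle lengths in a set P satisfies
     f(n+1) = sum of n(n-1)...(n-k+1) f(n-k) over the k <= n with k+1 in P.
   When P is r-periodic the terms with k >= r add up to
   (n-1)...(n-r+1) (n-r) f(n-r) in the expansion of f(n). Of the terms with
   k < r, Cyc only has k = r-1, of value (n-1)...(n-r+1) Cyc(n-r). For r | n, the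
   term k = r-2 of Reg has value (n-1)...(n-r+1) Reg(n-r), by the identity
   Reg(m+1) = (m+1) Reg(m) for r | m, and if r > 2 there is also a positive term
   k = 0. Induct on n/r. *)

Set Implicit Arguments.
Unset Strict Implicit.
Unset Printing Implicit Defensive.

(** * Splitting off the cycle through a point *)

Lemma eq_porbit_in (T : finType) (B : {set T}) (s t : {perm T}) x :
  {in B, forall y, s y \in B} -> {in B, s =1 t} -> x \in B ->
  porbit s x = porbit t x.
Proof.
move=> sB st xB.
have H i : (s ^+ i)%g x = (t ^+ i)%g x /\ (s ^+ i)%g x \in B.
  elim: i => [|i [IH1 IH2]]; first by rewrite !expg0 !perm1.
  by rewrite !expgSr !permM -IH1 st // -st // sB.
apply/setP=> y; apply/porbitP/porbitP => -[i ->]; exists i; by case: (H i).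
Qed.

Lemma porbit_sub_perm_on (T : finType) (A : {set T}) (s : {perm T}) x :
  perm_on A s -> x \in A -> porbit s x \subset A.
Proof.
move=> sA xA; apply/subsetP=> _ /porbitP[i ->].
by elim: i => [|i IH]; rewrite ?expg0 ?perm1 // expgSr permM perm_closed.
Qed.

(** Working inside a subset [A] of a fixed type lets the permutation left after removing a cycle [C]
    live on [A :\: C]. Testing [P] only at points of [A] ignores the fixed points outside. *)
Definition perms_cyc (P : pred nat) (T : finType) (A : {set T}) :
    {set {perm T}} :=
  [set s | perm_on A s & [forall x in A, P #|porbit s x|]].

Definition full_cycles (T : finType) (x : T) (C : {set T}) : {set {perm T}} :=
  [set u | perm_on C u & porbit u x == C].

Lemma perms_cycP (P : pred nat) (T : finType) (A : {set T}) (s : {perm T}) :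
  reflect (perm_on A s /\ {in A, forall x, P #|porbit s x|})
          (s \in perms_cyc P A).
Proof.
rewrite inE; apply: (iffP andP) => -[sA H]; split => //; first exact/forall_inP.
exact/forall_inP.
Qed.

(** The bijection sends a pair [(u, v)] to [u * v]; its inverse restricts [s] to [C] and to
    [A :\: C]. *)
Lemma card_perms_cyc_porbit (P : pred nat) (T : finType) (A C : {set T}) x :
  x \in C -> C \subset A -> P #|C| ->
  #|[set s in perms_cyc P A | porbit s x == C]| =
  #|full_cycles x C| * #|perms_cyc P (A :\: C)|.
Proof.
move=> xC CA PC.
have dC u v y : perm_on (A :\: C) v -> perm_on C u -> y \in C ->
    (u * v)%g y = u y.
  move=> vA uC yC; rewrite permM (out_perm vA) //.
  by rewrite inE perm_closed // yC.
have dA u v y : perm_on C u -> y \in A :\: C -> (u * v)%g y = v y.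
  by move=> uC /setDP[yA yC]; rewrite permM (out_perm uC).
rewrite -cardsX -(card_in_imset
  (f := fun p : {perm T} * {perm T} => (p.1 * p.2)%g)); last first.
  move=> [u v] [u' v']; rewrite !inE /=.
  move=> /andP[/andP[uC _] /andP[vA _]] /andP[/andP[uC' _] /andP[vA' _]] E.
  have E' : u = u'.
    apply/permP=> y; have [yC|yC] := boolP (y \in C).
      by rewrite -(dC u v) // E dC.
    by rewrite (out_perm uC) // (out_perm uC').
  by rewrite E' in E *; rewrite (mulgI _ _ _ E).
apply: eq_card => s; rewrite inE; apply/andP/imsetP => [[/perms_cycP[sA Ps] /eqP sC]|].
  have Cs y : (s y \in C) = (y \in C).
    by rewrite -sC -!eq_porbit_mem -[s y]/((s ^+ 1)%g y) porbit_perm.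
  (* [restr_perm] agrees with [s] only on sets that [s] stabilises, so both pieces need this. *)
  have NC : s \in 'N(C | 'P)%g by apply/astabsP => y; apply: Cs.
  have NA : s \in 'N(A :\: C | 'P)%g.
    by apply/astabsP => y; rewrite /= !inE /aperm Cs perm_closed.
  exists (restr_perm C s, restr_perm (A :\: C) s); last first.
    apply/permP=> y /=; have [yC|yC] := boolP (y \in C).
      by rewrite dC ?restr_perm_on // restr_permE.
    have [yA|yA] := boolP (y \in A).
      by rewrite dA ?restr_perm_on ?inE ?yC // restr_permE // inE yC.
    rewrite permM (out_perm (restr_perm_on _ _) yC).
    by rewrite (out_perm (restr_perm_on _ _)) ?(out_perm sA) // inE (negbTE yA) andbF.
  apply/setXP; split.
    rewrite inE restr_perm_on /= -[X in _ == X]sC; apply/eqP/esym.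
    apply: (@eq_porbit_in _ C) => // y yC; first by rewrite Cs.
    by rewrite restr_permE.
  apply/perms_cycP; split; first exact: restr_perm_on.
  move=> y yAC; rewrite -(@eq_porbit_in _ (A :\: C) s) //.
  - by apply: Ps; case/setDP: yAC.
  - by move=> z; rewrite !inE Cs perm_closed.
  - by move=> z zAC; rewrite restr_permE.
case=> -[u v] /setXP[/=]; rewrite inE => /andP[uC /eqP ux] /perms_cycP[vA Pv] ->.
have oC y : y \in C -> porbit (u * v)%g y = porbit u y.
  move=> yC; apply: (@eq_porbit_in _ C) => // z zC; last exact: dC.
  by rewrite dC // perm_closed.
have oA y : y \in A :\: C -> porbit (u * v)%g y = porbit v y.
  move=> yC; apply: (@eq_porbit_in _ (A :\: C)) => // z zC; last exact: dA.
  by rewrite dA // perm_closed.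
split; last by rewrite oC // ux.
apply/perms_cycP; split.
  apply: perm_onM; first exact: subset_trans uC CA.
  exact: subset_trans vA (subsetDl _ _).
move=> y yA; have [yC|yC] := boolP (y \in C); last first.
  by rewrite oA ?inE ?yC //; apply: Pv; rewrite inE yC.
have /eqP uy : porbit u y == porbit u x by rewrite eq_porbit_mem ux.
by rewrite oC // uy ux.
Qed.

(** Removing [x] turns the sets [C] of size k + 1 into the k-subsets of the n-set [A :\ x]. *)
Lemma big_card_subsets (T : finType) (A : {set T}) x n (F : nat -> nat)
    (P : pred nat) : x \in A -> #|A| = n.+1 ->
  \sum_(C : {set T} | [&& x \in C, C \subset A & P #|C|]) F #|C| =
  \sum_(k < n.+1 | P k.+1) 'C(n, k) * F k.+1.
Proof.
move=> xA cA.
have cA' : #|A :\ x| = n by move: cA; rewrite (cardsD1 x) xA => -[].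
transitivity (\sum_(B : {set T} | (B \subset A :\ x) && P #|B|.+1) F #|B|.+1).
  rewrite (reindex_onto (fun B => x |: B) (fun C => C :\ x)) /=; last first.
    by move=> C /and3P[xC _ _]; rewrite setD1K.
  have E (B : {set T}) : (x \in B) = false -> #|x |: B| = #|B|.+1.
    by move=> xB; rewrite cardsU1 xB.
  apply: eq_big => B; last first.
    move=> /andP[/and3P[_ _ _] /eqP xB]; rewrite E //.
    by apply/negbTE; rewrite -xB !inE eqxx.
  rewrite setU11 subUset sub1set xA /= subsetD1.
  have [xB|xB] := boolP (x \in B).
    rewrite andbF /=; apply/negbTE; rewrite negb_and; apply/orP; right.
    by apply: contraTneq xB => <-; rewrite !inE eqxx.
  by rewrite setU1K // eqxx !andbT E ?(negbTE xB).
rewrite (partition_big (fun B : {set T} => inord #|B| : 'I_n.+1)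
  (fun k => P k.+1)) /=; last first.
  move=> B /andP[BA PB]; rewrite inordK // ltnS -cA'; exact: subset_leq_card.
apply: eq_bigr => k Pk.
have <- : 'C(#|A :\ x|, k) = 'C(n, k) by rewrite cA'.
rewrite -cards_draws.
rewrite (eq_bigl (mem [set B : {set T} | B \subset A :\ x & #|B| == k])); last first.
  move=> B; rewrite !inE; have [BA|//] := boolP (B \subset _).
  have ltB : #|B| < n.+1 by rewrite ltnS -cA'; exact: subset_leq_card.
  rewrite -(inj_eq val_inj) /= inordK //.
  by case: eqP => [->|]; rewrite ?Pk ?andbF.
rewrite (eq_bigr (fun=> F k.+1)) ?sum_nat_const //.
by move=> B /[!inE] /andP[_ /eqP ->].
Qed.

Lemma card_perms_cycE (P : pred nat) (T : finType) (A : {set T}) x : x \in A ->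
  #|perms_cyc P A| =
  \sum_(C : {set T} | [&& x \in C, C \subset A & P #|C|])
     #|full_cycles x C| * #|perms_cyc P (A :\: C)|.
Proof.
move=> xA; rewrite -sum1_card.
rewrite (partition_big (fun s => porbit s x)
  (fun C => [&& x \in C, C \subset A & P #|C|])) /=; last first.
  by move=> s /perms_cycP[sA Ps]; rewrite porbit_id porbit_sub_perm_on // Ps.
apply: eq_bigr => C /and3P[xC CA PC].
by rewrite -card_perms_cyc_porbit // -sum1_card; apply: eq_bigl => s; rewrite inE.
Qed.

(** * Counting the cycles on a given set *)

Lemma card_perms_cyc_predT (T : finType) (A : {set T}) :
  #|perms_cyc predT A| = #|A|`!.
Proof.
rewrite -card_perm; apply: eq_card => s; rewrite [LHS]inE -[RHS]/(perm_on A s).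
by apply: andb_idr => _; apply/forall_inP.
Qed.

(* For [P := predT] the orbit decomposition reads
   [n.+1`! = \sum_C #|full_cycles x C| * #|A :\: C|`!], and this determines the
   term [C = A] from the smaller ones. *)
Lemma card_full_cycles (T : finType) (A : {set T}) x : x \in A ->
  #|full_cycles x A| = #|A|.-1`!.
Proof.
move: {2}#|A| (erefl #|A|) => n; elim/ltn_ind: n A => -[|n] IH A cA xA.
  by rewrite (cards0_eq cA) inE in xA.
rewrite cA /=.
have := card_perms_cycE predT xA.
rewrite card_perms_cyc_predT (bigD1 A) /=; last by rewrite xA subxx.
rewrite setDv card_perms_cyc_predT cards0 muln1 cA.
set S := \sum_(i | _) _.
have -> : S = n * n`!.
  (* The value 0 at [n.+1] discards the term [C = A]; each of the n other sizes contributes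
     ['C(n, k) * k! * (n - k)! = n!]. *)
  pose F k := if k == n.+1 then 0 else k.-1`! * (n.+1 - k)`!.
  have E := big_card_subsets F predT xA cA.
  rewrite (bigD1 A) /= in E; last by rewrite xA subxx.
  rewrite {1}/F cA eqxx add0n in E.
  transitivity (\sum_(i < n.+1) 'C(n, i) * F i.+1).
    rewrite -E; apply: eq_bigr => C /andP[/and3P[xC CA _] nCA].
    have ltC : #|C| < n.+1 by rewrite -cA proper_card // properEneq nCA.
    rewrite card_perms_cyc_predT (IH #|C|) // /F (ltn_eqF ltC) cardsD.
    by rewrite (setIidPr CA) cA.
  rewrite big_ord_recr /= /F eqxx muln0 addn0.
  rewrite (eq_bigr (fun=> n`!)) ?sum_nat_const ?card_ord //.
  by move=> k _; rewrite eqSS (ltn_eqF (ltn_ord k)) subSS /= bin_fact // ltnW.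
by rewrite factS mulSn => /addIn.
Qed.

(** * The counts as a function of n alone, and their recursion *)

Definition nperms_cyc (P : pred nat) (n : nat) : nat :=
  #|perms_cyc P [set: 'I_n]|.

(** A cycle of length k + 1 through [x] has ['C(n, k)] supports and k! arrangements on each, whence
    [n ^_ k]. *)
Lemma card_perms_cyc_rec (P : pred nat) (T : finType) (A : {set T}) n :
    #|A| = n.+1 ->
    (forall (B : {set T}), #|B| < n.+1 -> #|perms_cyc P B| = nperms_cyc P #|B|) ->
  #|perms_cyc P A| = \sum_(k < n.+1 | P k.+1) n ^_ k * nperms_cyc P (n - k).
Proof.
move=> cA IH.
have [x xA] : exists x, x \in A by apply/card_gt0P; rewrite cA.
have := big_card_subsets (fun k => k.-1`! * nperms_cyc P (n.+1 - k)) P xA cA.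
rewrite (card_perms_cycE _ xA) => E.
transitivity (\sum_(k < n.+1 | P k.+1)
  'C(n, k) * (k.+1.-1`! * nperms_cyc P (n.+1 - k.+1))); last first.
  by apply: eq_bigr => k _; rewrite mulnA bin_ffact subSS.
rewrite -E; apply: eq_bigr => C /and3P[xC CA PC].
have cD : #|A :\: C| = n.+1 - #|C| by rewrite cardsD (setIidPr CA) cA.
rewrite card_full_cycles // IH cD // ltn_subrL andbT.
by apply/card_gt0P; exists x.
Qed.

Lemma card_perms_cyc0 (P : pred nat) (T : finType) :
  #|perms_cyc P (set0 : {set T})| = 1.
Proof.
rewrite -(cards1 (1 : {perm T})%g); apply: eq_card => s.
apply/perms_cycP/set1P => [[s0 _]|->].
  by apply/permP=> y; rewrite perm1 (out_perm s0) // inE.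
by split; [exact: perm_on1 | move=> y; rewrite inE].
Qed.

Lemma nperms_cyc0 (P : pred nat) : nperms_cyc P 0 = 1.
Proof.
rewrite -(card_perms_cyc0 P 'I_0) /nperms_cyc; congr #|perms_cyc P _|.
by apply/setP=> -[].
Qed.

(** [A] and the full set of ['I_n] obey the same recursion with the same smaller values; the
    induction ranges over all types [T]. *)
Lemma card_perms_cyc (P : pred nat) (T : finType) (A : {set T}) :
  #|perms_cyc P A| = nperms_cyc P #|A|.
Proof.
move: {2}#|A| (leqnn #|A|) => n.
elim: n T A => [|n IH] T A; last first.
  rewrite leq_eqVlt => /orP[/eqP cA|]; last exact: IH.
  rewrite (@card_perms_cyc_rec _ _ _ n) //; last by move=> B; apply: IH.
  rewrite /nperms_cyc cA (@card_perms_cyc_rec _ _ _ n) ?cardsT ?card_ord //.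
  by move=> B; apply: IH.
rewrite leqn0 cards_eq0 => /eqP ->.
by rewrite cards0 card_perms_cyc0 nperms_cyc0.
Qed.

Lemma nperms_cycS (P : pred nat) n :
  nperms_cyc P n.+1 = \sum_(k < n.+1 | P k.+1) n ^_ k * nperms_cyc P (n - k).
Proof.
rewrite {1}/nperms_cyc (@card_perms_cyc_rec _ _ _ n) ?cardsT ?card_ord // => B _.
exact: card_perms_cyc.
Qed.

Lemma nperms_cycE (P : pred nat) n :
  #|[set s : 'S_n | [forall c in porbits s, P #|c|]]| = nperms_cyc P n.
Proof.
apply: eq_card => s; rewrite inE; apply/forall_inP/perms_cycP => [H|[_ H] c].
  split; first by apply/subsetP=> x _; apply: in_setT.
  by move=> x _; apply: H; apply: imset_f.
by case/imsetP=> x _ ->; apply: H.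
Qed.

(** * Recursion of step r for periodic conditions *)

Lemma ffactD n k l : n ^_ (k + l) = n ^_ k * (n - k) ^_ l.
Proof.
elim: k n => [|k IH] n; first by rewrite subn0 mul1n.
case: n => [|n]; first by rewrite addSn !ffact0n.
by rewrite addSn !ffactSS IH subSS mulnA.
Qed.

Lemma nperms_cyc_periodic (P : pred nat) r n :
    0 < r -> (forall k, P (r + k) = P k) ->
  nperms_cyc P (n + r) =
  \sum_(k < r | P k.+1) (n + r).-1 ^_ k * nperms_cyc P ((n + r).-1 - k)
  + (n + r).-1 ^_ r.-1 * n * nperms_cyc P n.
Proof.
case: r => // r _ Pr; rewrite addnS /= nperms_cycS.
rewrite -(big_mkord (fun k => P k.+1)
  (fun k => (n + r) ^_ k * nperms_cyc P (n + r - k))).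
rewrite (@big_cat_nat _ _ _ r.+1) //=; last by rewrite ltnS leq_addl.
rewrite big_mkord; congr (_ + _).
rewrite -{1}[r.+1]add0n big_addn -addnS addnK big_mkord.
(* For n = 0 the tail is empty and the factor n vanishes. Otherwise shifting k by the period, now
   written [r.+1], leaves the recursion for the count at [n.+1]. *)
case: n => [|n]; first by rewrite big_ord0 muln0.
rewrite nperms_cycS big_distrr /=.
apply: eq_big => [k|k _]; first by rewrite addnC -addnS Pr.
have En : n.+1 + r - r.+1 = n by rewrite addSnnS addnK.
by rewrite [k + _]addnC ffactD subnDA En ffactnSr addnK !mulnA.
Qed.

(** * Comparing the two counts *)

Section Regular.

Variable r : nat.
Hypothesis r_gt1 : 1 < r.

Local Notation reg := (nperms_cyc (fun k => ~~ (r %| k))).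
Local Notation cyc := (nperms_cyc (fun k => r %| k)).

(** The sum of all [F k] is split in two ways, by whether r divides k + 1 or k; the common part [S]
    cancels. *)
Lemma nregS n : r %| n -> reg n.+1 = n.+1 * reg n.
Proof.
elim/ltn_ind: n => n IH rn.
pose F k := n ^_ k * reg (n - k).
pose S := \sum_(k < n.+1 | r %| k.+1) F k.
have sumS : \sum_(k < n.+1) F k = S + reg n.+1.
  by rewrite nperms_cycS (bigID (fun k : 'I_n.+1 => r %| k.+1)).
have sum_reg : \sum_(k < n.+1 | ~~ (r %| k)) F k = n * reg n.
  rewrite big_mkcond big_ord_recl /= dvdn0 add0n -big_mkcond /=.
  case: (n) @F {S sumS} => [|m] F; first by rewrite big_ord0.
  rewrite nperms_cycS big_distrr /=; apply: eq_bigr => k _.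
  by rewrite /F ffactSS subSS mulnA.
(* Apart from k = 0, [F k.+1] equals [F k] when r divides k + 1: the induction hypothesis at n - k -
   1 supplies the factor n - k. The last index k = n drops out of [S], since r divides n and so not
   n + 1. *)
have sum_dvd : \sum_(k < n.+1 | r %| k) F k = reg n + S.
  rewrite big_mkcond big_ord_recl /= dvdn0 -big_mkcond /F subn0 mul1n.
  congr (_ + _); rewrite /S [RHS]big_mkcond big_ord_recr /= -big_mkcond /=.
  rewrite -addn1 dvdn_addr // dvdn1 gtn_eqF // addn0.
  apply: eq_bigr => k rk; have lt_kn := ltn_ord k.
  rewrite /F -(subnSK lt_kn) IH ?dvdn_sub // ?ltn_subrL ?(leq_trans _ lt_kn) //.
  by rewrite ffactnSr -mulnA subnSK.
apply: (@addnI S); rewrite -sumS (bigID (fun k : 'I_n.+1 => r %| k)) /=.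
by rewrite sum_reg sum_dvd -addnA addnCA mulSn.
Qed.

Lemma ncyc_addr n : cyc (n + r) = (n + r).-1 ^_ r.-1 * n.+1 * cyc n.
Proof.
rewrite nperms_cyc_periodic ?(ltnW r_gt1) // => [|k]; last by rewrite dvdn_addr.
case: r r_gt1 => // s _; rewrite (big_pred1 ord_max) => [|k] /=.
  by rewrite addnS /= addnK mulnS mulnDl.
rewrite -(inj_eq val_inj) /= -eqSS; apply/idP/eqP => [|->] //.
by move/dvdn_leq=> /(_ isT) le; apply/eqP; rewrite eqn_leq le ltn_ord.
Qed.

Lemma nreg_gt0 n : 0 < reg n.
Proof.
apply/card_gt0P; exists 1%g; apply/perms_cycP; split; first exact: perm_on1.
move=> x _; have -> : #|porbit 1 x| = 1; last by rewrite dvdn1 gtn_eqF.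
apply/eqP; rewrite eqn_leq lt0n card_porbit_neq0 andbT -(cards1 x).
by apply: subset_leq_card; rewrite porbit_sub_perm_on ?perm_on1 ?set11.
Qed.

Lemma nreg_addr n : r %| n ->
  (n + r).-1 ^_ r.-1 * n.+1 * reg n + (2 < r) <= reg (n + r).
Proof.
move=> rn; rewrite nperms_cyc_periodic ?(ltnW r_gt1) // => [|k]; last first.
  by rewrite dvdn_addr.
rewrite mulnS mulnDl addnAC leq_add2r.
case: r r_gt1 (nregS rn) nreg_gt0 => [|[|s]] //= _ regS gt0.
have ltS : s < s.+2 by rewrite ltnS leqnSn.
have ndvd k : k.+1 < s.+2 -> ~~ (s.+2 %| k.+1).
  by move=> lt; rewrite gtnNdvd.
(* With r = s + 2, this is the term k = r - 2, where [nregS] applies to [reg n.+1]. *)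
rewrite (bigD1 (Ordinal ltS)) /=; last exact: ndvd.
apply: leq_add; rewrite addnS /=.
  have En : n + s.+1 - s = n.+1 by rewrite -addSnnS addnK.
  by rewrite ffactnSr En regS mulnA.
(* For r = 2 the index k = 0 is already used; for r > 2 it is a separate positive term. *)
case: s {regS} ltS ndvd gt0 => // s ltS ndvd gt0.
rewrite (bigD1 ord0) //=.
by rewrite ffactn0 mul1n addn_gt0 gt0.
Qed.

(** The boolean summand records strictness. It is produced afresh at each step by [nreg_addr]; at m
    = 0 both counts are 1. *)
Lemma ncyc_le_nreg_mul m :
  cyc (m * r) + ((0 < m) && (2 < r)) <= reg (m * r).
Proof.
elim: m => [|m IH]; first by rewrite mul0n !nperms_cyc0.
rewrite mulSnr ncyc_addr; apply: leq_trans (nreg_addr (dvdn_mull m (dvdnn r))).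
by rewrite leq_add2r leq_mul2l (leq_trans (leq_addr _ _) IH) orbT.
Qed.

(** For 0 < n < r the recursion has no admissible term; beyond that, [ncyc_addr] carries the
    vanishing from n - r to n. *)
Lemma ncyc_eq0 n : ~~ (r %| n) -> cyc n = 0.
Proof.
elim/ltn_ind: n => n IH rn; have [lt_nr|le_rn] := ltnP n r.
  case: n rn {IH} lt_nr => [|n]; rewrite ?dvdn0 // => _ lt_nr.
  rewrite nperms_cycS big_pred0 // => k.
  by rewrite gtnNdvd // (leq_ltn_trans _ lt_nr) // -ltnS.
have r0 := ltnW r_gt1.
rewrite -(subnK le_rn) ncyc_addr IH ?muln0 ?ltn_subrL ?r0 ?(leq_trans r0) //.
by rewrite dvdn_subl.
Qed.

End Regular.

Theorem theorem3p4 (r n : nat) (hr : 2 <= r) (hn : 1 <= n) :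
  #|Cyc r n| <= #|Reg r n| /\
  (#|Cyc r n| = #|Reg r n| -> r = 2 /\ ~~ odd n).
Proof.
rewrite /Cyc /Reg (nperms_cycE (fun k => r %| k)) (nperms_cycE (fun k => ~~ (r %| k))).
(* If r does not divide n, equality would contradict the positivity of [reg n]. *)
have [rn|/ncyc_eq0-> //] := boolP (r %| n); last first.
  by split=> // reg0; have := nreg_gt0 hr n; rewrite -reg0.
case/dvdnP: rn hn => m -> mr.
have := ncyc_le_nreg_mul hr m.
have -> : 0 < m by case: m mr.
move: hr; rewrite leq_eqVlt => /orP[/eqP <-|r_gt2] /=.
  by rewrite addn0; split=> //; rewrite oddM andbF.
by rewrite r_gt2 addn1 => lt; split=> [|E]; [exact: ltnW | rewrite E ltnn in lt].
Qed.
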